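(* Let $Y_1,\dots,Y_n$ be independent real random variables with joint law $P$ and respective c.d.f.'s $F_1,\dots,F_n$, let $\alpha\in(0,1)$ and $k\in[0,n-1]$. Consider any c.d.f. $F_0$. Then the test rejecting the null hypothesis $H_0'$: ''$F_0\in\mathcal F_{0,k}(P)$'' whenever $F_0\notin\mathcal F_{1-\alpha}(Y)$, that is, whenever there exists $j\in\{0,\dots,n\}$ such that $\widehat a_n(j;F_0)>\widehat b_n(j;F_0)$, is of level $\alpha$ (i.e. if $F_0\in\mathcal F_{0,k}(P)$ then $\mathbb P(F_0\notin\mathcal F_{1-\alpha}(Y))\le\alpha$).
   Context: Definitions. $\mathcal F_{0,k}(P)=\{F_0\text{ c.d.f. on }\mathbb R:\ |\{i\in\{1,\dots,n\}: F_i=F_0\}|\ge n-k\}$. Let $Y_{(1)}\le\dots\le Y_{(n)}$ be the order statistics of $(Y_i)_{1\le i\le n}$, with $Y_{(0)}=-\infty$, $Y_{(n+1)}=+\infty$; for a c.d.f. $F_0$, $F_0(y^-)=\lim_{x\to y^-}F_0(x)$ (with $F_0(-\infty)=0$, $F_0(+\infty^-)=1$). Write $x\vee y=\max(x,y)$, $x\wedge y=\min(x,y)$. Let $c_{n,\alpha}=\{-(1-k/n)\log(\alpha/2)/(2n)\}^{1/2}$ and, for $j\in\{0,\dots,n\}$, $$\widehat a_n(j;F_0)=0\vee\frac{\max_{0\le\ell\le j}\{\ell/n-(1-k/n)F_0(Y_{(\ell)})\}-c_{n,\alpha}}{k/n},$$ $$\widehat b_n(j;F_0)=1\wedge\frac{\min_{j\le\ell\le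 n}\{\ell/n-(1-k/n)F_0(Y_{(\ell+1)}^-)\}+c_{n,\alpha}}{k/n},$$ $$\mathcal F_{1-\alpha}(Y)=\{F_0\text{ c.d.f.}:\ \forall j\in\{0,\dots,n\},\ \widehat a_n(j;F_0)\le\widehat b_n(j;F_0)\}.$$ When $k=0$, quotients by $k/n=0$ are understood as $+\infty$, $-\infty$ or $0$ according to whether the numerator is positive, negative or zero. *)

(* Defs.v *)
From HB Require Import structures.
From mathcomp Require Import all_boot all_order all_algebra.
From mathcomp Require Import all_classical all_reals all_analysis.

Set Implicit Arguments.
Unset Strict Implicit.
Unset Printing Implicit Defensive.

Import Order.TTheory GRing.Theory Num.Theory.
Import numFieldNormedType.Exports.

Local Open Scope classical_set_scope.
Local Open Scope ring_scope.

(* Bundled functions R -> R that are nondecreasing, right-continuous, with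
   limit 0 at -oo and 1 at +oo. *)
Notation cdf_on R := (cumulativeBounded (0 : R) (1 : R)).

(* Mutual independence, as the product rule over every subfamily. *)
Definition mutually_independent d (T : measurableType d) (R : realType)
    (P : probability T R) (n : nat) (Y : 'I_n -> {RV P >-> R}) : Prop :=
  forall (J : {set 'I_n}) (B : 'I_n -> set R),
    (forall i, measurable (B i)) ->
    P (\bigcap_(i in [set` J]) (Y i @^-1` B i)) =
    (\prod_(i in J) P (Y i @^-1` B i))%E.

(* F_{0,k}(P), which depends on the joint law P only through the marginal
   c.d.f.'s F_1, ..., F_n; the library's cdf is \bar R-valued. *)
Definition null_cdfs (R : realType) (n : nat) (k : R) (F : 'I_n -> R -> \bar R)
    : set (cdf_on R) :=
  [set F0 : cdf_on R |
    n%:R - k <= #|[set i : 'I_n | `[< F i = EFin \o F0 >]]%SET|%:R].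

(* Y_(l) for 0 <= l <= n + 1, with Y_(0) = -oo and Y_(n+1) = +oo, the latter
   being the default value of nth. *)
Definition order_stat (R : realType) (n : nat) (y : 'I_n -> R) (l : nat)
    : \bar R :=
  nth +oo%E (-oo%E :: [seq x%:E | x <- sort <=%R [seq y i | i <- enum 'I_n]]) l.

Definition cdf_ext (R : realType) (F0 : cdf_on R) (y : \bar R) : R :=
  match y with
  | r%:E => F0 r
  | +oo%E => 1
  | -oo%E => 0
  end.

(* F_0(y^-); the value at -oo is never used. *)
Definition cdf_ext_left (R : realType) (F0 : cdf_on R) (y : \bar R) : R :=
  match y with
  | r%:E => lim (F0 x @[x --> r^'-])
  | +oo%E => 1
  | -oo%E => 0
  end.

Definition c_ (R : realType) (n : nat) (k alpha : R) : R :=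
  Num.sqrt (- (1 - k / n%:R) * ln (alpha / 2) / (2 * n%:R)).

(* In \bar R, division by 0 is multiplication by +oo, and 0 * +oo = 0: this is
   the convention for the quotients by k / n when k = 0.  The bounds -oo and +oo
   are neutral for the maximum and the minimum, whose ranges contain j. *)
Definition a_hat (R : realType) (n : nat) (k alpha : R) (y : 'I_n -> R)
    (F0 : cdf_on R) (j : 'I_n.+1) : \bar R :=
  maxe 0%E
    ((\big[maxe/-oo%E]_(l < n.+1 | (l <= j)%N)
        (l%:R / n%:R - (1 - k / n%:R) * cdf_ext F0 (order_stat y l))%:E
      - (c_ n k alpha)%:E) / (k / n%:R)%:E)%E.

Definition b_hat (R : realType) (n : nat) (k alpha : R) (y : 'I_n -> R)
    (F0 : cdf_on R) (j : 'I_n.+1) : \bar R :=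
  mine 1%E
    ((\big[mine/+oo%E]_(l < n.+1 | (j <= l)%N)
        (l%:R / n%:R
         - (1 - k / n%:R) * cdf_ext_left F0 (order_stat y l.+1))%:E
      + (c_ n k alpha)%:E) / (k / n%:R)%:E)%E.

(* F_{1-alpha}(y), for a realization y of (Y_1, ..., Y_n). *)
Definition confidence_region (R : realType) (n : nat) (k alpha : R)
    (y : 'I_n -> R) : set (cdf_on R) :=
  [set F0 : cdf_on R |
    forall j : 'I_n.+1, (a_hat k alpha y F0 j <= b_hat k alpha y F0 j)%E].

(* Main.v *)
Require Import Defs.
From mathcomp Require Import all_boot all_order all_algebra.
From mathcomp Require Import ring lra.
From mathcomp Require Import all_classical all_reals all_analysis.
From mathcomp Require Import measurable_realfun.

(** Let m be the number of indices i with F_i = F0 (the good indices) and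
s = n - k, so that s <= m.  The theorem is the one-sided
Dvoretzky-Kiefer-Wolfowitz inequality with Massart's constant, applied twice.

The inequality [superuniform_exceeds_band_le] says that for m independent
variables Z_i with P (Z_i < u) <= max 0 u,

  P (exists j in 1..m, at least j of the Z_i are < j / m - e)
    <= exp (- 2 m e ^ 2).

It is used with Z_i = F0 (Y_i) and with Z_i = 1 - F0 (Y_i^-), i good, and
e = n c / s, where c is the constant of the confidence region.  Each of the two
probabilities is then at most exp (- (m / s) ln (2 / alpha)) <= alpha / 2.
Outside both events the empirical c.d.f. of the good observations stays within e
of F0.  Give every good observation the weight theta = s / m: the good
observations then weigh s in total, whether k is an integer or not, and the
weighted number of good observations up to x, divided by n, stays within c of
(1 - k / n) F0 x.  What remains is the distribution function of a positive
measure (weight 1 - theta on good observations and 1 on the others, divided by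
n) of total mass k / n; it is nondecreasing with values in [0, k / n], so it
separates the lower bounds from the upper bounds
[confidence_region_of_deviation].

The inequality is proved by a change of measure.  Let u_j = j / m - e, and
replace the law P_i of Z_i by Q_i = c P_i + (1 - c) delta, where delta charges
the region below all thresholds.  Scan the thresholds downwards from u_m and
stop at the first j such that at least j points lie below u_j.  The exact
positions of the points below u_j are then still unseen, so the likelihood ratio
of Q to P at that time is c for each point above u_j and
c + (1 - c) / P_i (Z_i < u_j) >= c + (1 - c) / u_j for each point below it; it
is at least (c + (1 - c) / u_j) ^ j c ^ (m - j).  The stopping events for
different j are disjoint, so their Q-probabilities add up to at most 1
[sum_crossed_le].  It remains to find one c for which this lower bound is at
least exp (2 m e ^ 2) for every j with u_j > 0; almost surely, no point lies
below the other thresholds.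

For t = u_j, with r = (1 - c) / c and x = ln (1 + r / t), the logarithm of the
lower bound is m times r B x + e x - ln (1 + r), where B x = x / (exp x - 1) is
convex [bernoulli_fun_tangent]; a stationary point in x is therefore a global
minimum.  Choose p stationary for p |-> KL (p + e, p), the relative entropy of
two Bernoulli laws [stationary_point_exists], and c = (1 - p - e) / (1 - p).
Then t = p is the stationary point and the minimum is KL (p + e, p), which is at
least 2 e ^ 2 by Pinsker's inequality [pinsker_bernoulli, tilt_exponent]. *)

Set Implicit Arguments.
Unset Strict Implicit.
Unset Printing Implicit Defensive.

Import Order.TTheory GRing.Theory Num.Theory.
Import numFieldNormedType.Exports.

Local Open Scope classical_set_scope.
Local Open Scope ring_scope.

(** * Calculus on the real line *)

(** The derivation rules for functions given by a pointwise expression, which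
[differentiate] composes by following the syntax of that expression. *)
Section pointwise_derivation_rules.
Variables (R : realType) (f g : R -> R) (x df dg : R).

Lemma is_derive_ptD : is_derive x 1 f df -> is_derive x 1 g dg ->
  is_derive x 1 (fun y => f y + g y) (df + dg).
Proof. exact: is_deriveD. Qed.

Lemma is_derive_ptN : is_derive x 1 f df ->
  is_derive x 1 (fun y => - f y) (- df).
Proof. exact: is_deriveN. Qed.

Lemma is_derive_ptM : is_derive x 1 f df -> is_derive x 1 g dg ->
  is_derive x 1 (fun y => f y * g y) (f x * dg + g x * df).
Proof. exact: is_deriveM. Qed.

Lemma is_derive_ptV : f x != 0 -> is_derive x 1 f df ->
  is_derive x 1 (fun y => (f y)^-1) (- (f x) ^- 2 * df).
Proof. exact: is_deriveV. Qed.

Lemma is_derive_pt_cst (c : R) : is_derive x 1 (fun=> c) 0.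
Proof. exact: is_derive_cst. Qed.

Lemma is_derive_pt_id : is_derive x 1 (fun y : R => y) 1.
Proof. exact: is_derive_id. Qed.

End pointwise_derivation_rules.

Lemma is_derive_ptX (R : realType) (f : R -> R) (n : nat) (x df : R) :
  is_derive x 1 f df ->
  is_derive x 1 (fun y => f y ^+ n) (n%:R * f x ^+ n.-1 * df).
Proof. by move=> dfx; rewrite -exprfctE; exact: is_deriveX. Qed.

Lemma is_derive_pt_ln (R : realType) (f : R -> R) (x df : R) :
  0 < f x -> is_derive x 1 f df ->
  is_derive x 1 (fun y => ln (f y)) ((f x)^-1 * df).
Proof.
by move=> fx0 dfx; apply: (@is_derive1_comp R (@ln R)); exact: is_derive1_ln.
Qed.

Ltac differentiate := eapply is_derive_eq;
  [repeat first [eassumption | apply: is_derive_expR | apply: is_derive_pt_cst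
    | apply: is_derive_pt_id
    | apply: is_derive_ptD | apply: is_derive_ptN | apply: is_derive_ptM
    | apply: is_derive_ptX | (apply: is_derive_ptV; first by [])
    | (apply: is_derive_pt_ln; first by [])] | ].

Lemma ge0_is_derive_le (R : realType) (f df : R -> R) (a b : R) : a <= b ->
  (forall x, a <= x <= b -> is_derive x 1 f (df x)) ->
  (forall x, a <= x <= b -> 0 <= df x) -> f a <= f b.
Proof.
move=> ab fdf df0.
have [| |c] := @MVT_segment R f df _ _ ab.
- by move=> x; rewrite in_itv/= => /andP[/ltW ? /ltW ?]; apply: fdf; apply/andP.
- apply: derivable_within_continuous => x; rewrite in_itv/= => /fdf xf.
  exact: ex_derive.
rewrite in_itv/= => /df0 c0 fE.
by rewrite -subr_ge0 fE mulr_ge0// subr_ge0.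
Qed.

(** The inequality y <= sinh y at y = ln x. *)
Lemma ln_le_half_sub_inv (R : realType) (x : R) : 1 <= x ->
  ln x <= (x - x^-1) / 2.
Proof.
move=> x1.
pose f (y : R) := (y - y^-1) / 2 - ln y.
suff : f 1 <= f x by rewrite /f ln1 invr1 subrr mul0r subr0 subr_ge0.
apply: (@ge0_is_derive_le R f (fun y => (1 - y^-1) ^+ 2 / 2)) => //.
- move=> y /andP[y1 _]; have y0 : 0 < y by lra.
  have yn0 : y != 0 by rewrite gt_eqF.
  rewrite /f; differentiate.
  rewrite /GRing.scale /=; field.
  by [].
- by move=> y _; rewrite divr_ge0 ?sqr_ge0.
Qed.

(** The numerator of the second derivative of s / (exp s - 1), up to a positive
factor; its own derivative 1 - (1 - s) exp s is nonnegative because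
exp (- s) >= 1 - s. *)
Lemma expR_pade_ge0 (R : realType) (s : R) : 0 <= s ->
  0 <= (s - 2) * expR s + s + 2.
Proof.
move=> s0.
pose f s : R := (s - 2) * expR s + s + 2.
suff : f 0 <= f s by rewrite {1}/f expR0 (_ : (0 - 2) * 1 + 0 + 2 = 0)//; ring.
apply: (@ge0_is_derive_le R f (fun y => (y - 1) * expR y + 1)) => //.
- move=> y _; rewrite /f; differentiate; rewrite /GRing.scale /=; ring.
- move=> y _; have := expR_ge1Dx (- y); rewrite expRN => h.
  have e0 := expR_gt0 y.
  rewrite -(ler_pM2r e0) mulVf ?gt_eqF// in h; lra.
Qed.

(** The generating function of the Bernoulli numbers. *)
Definition bernoulli_fun (R : realType) (s : R) : R := s / (expR s - 1).
Definition bernoulli_fun_deriv (R : realType) (s : R) : R :=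
  (expR s - 1 - s * expR s) / (expR s - 1) ^+ 2.

Lemma expR_sub1_gt0 (R : realType) (s : R) : 0 < s -> 0 < expR s - 1.
Proof. by move=> s0; rewrite subr_gt0 expR_gt1. Qed.

Lemma bernoulli_fun_deriv_ndecr (R : realType) (s t : R) : 0 < s -> s <= t ->
  bernoulli_fun_deriv s <= bernoulli_fun_deriv t.
Proof.
move=> s0 st.
apply: (@ge0_is_derive_le R (@bernoulli_fun_deriv R)
  (fun s => expR s * ((s - 2) * expR s + s + 2) / (expR s - 1) ^+ 3)) => //.
- move=> y /andP[sy _]; have y0 : 0 < y by lra.
  have e0 : expR y - 1 != 0 by rewrite gt_eqF// expR_sub1_gt0.
  have e20 : (expR y - 1) ^+ 2 != 0 by rewrite expf_neq0.
  rewrite /bernoulli_fun_deriv.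
  differentiate.
  rewrite /GRing.scale /=; field.
  by [].
- move=> y /andP[sy _]; have y0 : 0 < y by lra.
  rewrite divr_ge0// ?mulr_ge0 ?expR_ge0 ?expR_pade_ge0 ?exprn_ge0// ltW//.
  all: exact: expR_sub1_gt0.
Qed.

(** Convexity of s / (exp s - 1) on the positive half-line, in the form used
below: the graph lies above its tangents. *)
Lemma bernoulli_fun_tangent (R : realType) (s t : R) : 0 < s -> 0 < t ->
  bernoulli_fun s + bernoulli_fun_deriv s * (t - s) <= bernoulli_fun t.
Proof.
move=> s0 t0.
have db (x : R) : 0 < x ->
    is_derive x 1 (@bernoulli_fun R) (bernoulli_fun_deriv x).
  move=> x0; have e0 : expR x - 1 != 0 by rewrite gt_eqF// expR_sub1_gt0.
  rewrite /bernoulli_fun; differentiate.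
  by rewrite /bernoulli_fun_deriv /GRing.scale /=; field.
have mvt (a b : R) : 0 < a -> a <= b ->
    exists2 c, a <= c <= b &
      bernoulli_fun b - bernoulli_fun a = bernoulli_fun_deriv c * (b - a).
  move=> a0 ab.
  have [| |c] :=
    @MVT_segment R (@bernoulli_fun R) (@bernoulli_fun_deriv R) _ _ ab.
  - move=> x; rewrite in_itv/= => /andP[ax _]; apply: db; lra.
  - apply: derivable_within_continuous => x; rewrite in_itv/= => /andP[ax _].
    have dbx : is_derive x 1 (@bernoulli_fun R) (bernoulli_fun_deriv x).
      by apply: db; lra.
    exact: ex_derive.
  by rewrite in_itv/=; exists c.
have [st|ts] := leP s t.
  have [c /andP[sc ct] h] := mvt s t s0 st.
  have := @bernoulli_fun_deriv_ndecr R s c s0 sc; nra.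
have [c /andP[sc ct] h] := mvt t s t0 (ltW ts).
have := @bernoulli_fun_deriv_ndecr R c s (lt_le_trans t0 sc) ct; nra.
Qed.

(** Pinsker's inequality for Bernoulli laws: as a function of q, the difference
of the two sides vanishes at p together with its derivative, and its second
derivative is 1 / (q (1 - q)) - 4 >= 0. *)
Lemma pinsker_bernoulli (R : realType) (p q : R) : 0 < p -> p <= q -> q < 1 ->
  2 * (q - p) ^+ 2 <=
  q * (ln q - ln p) + (1 - q) * (ln (1 - q) - ln (1 - p)).
Proof.
move=> p0 pq q1.
pose g (y : R) := ln y - ln p - (ln (1 - y) - ln (1 - p)) - 4 * (y - p).
have g0 y : p <= y <= q -> 0 <= g y.
  move=> /andP[py yq].
  rewrite (_ : 0 = g p); last by rewrite /g !subrr mulr0 subr0.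
  apply: (@ge0_is_derive_le R g
    (fun y => (1 - 2 * y) ^+ 2 / (y * (1 - y)))) => //.
    move=> x /andP[px xy].
    have x0 : 0 < x by lra.
    have x1 : 0 < 1 - x by lra.
    rewrite /g; differentiate; rewrite /GRing.scale /=; field.
    by rewrite !gt_eqF.
  move=> x /andP[px xy]; rewrite divr_ge0 ?sqr_ge0// mulr_ge0//; lra.
pose f (y : R) :=
  y * (ln y - ln p) + (1 - y) * (ln (1 - y) - ln (1 - p)) - 2 * (y - p) ^+ 2.
suff : f p <= f q by rewrite /f !subrr !mulr0 expr0n/= mulr0 subr0 addr0; lra.
apply: (@ge0_is_derive_le R f g) => // y pyq.
have /andP[py yq] := pyq.
have x0 : 0 < y by lra.
have x1 : 0 < 1 - y by lra.
rewrite /f; differentiate; rewrite /GRing.scale /= /g; field.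
by rewrite !gt_eqF.
Qed.

(** * The optimal tilt *)

(** The displayed equation says that p is a critical point of the relative
entropy of the Bernoulli law p + e with respect to the Bernoulli law p.  It is
solved by the intermediate value theorem between the symmetric point
(1 - e) / 2, where sinh y >= y gives the sign, and a point so close to 1 - e
that the logarithm dominates. *)
Lemma stationary_point_exists (R : realType) (e : R) : 0 < e < 1 ->
  exists p, [/\ 0 < p, p + e < 1 &
    ln (1 + e / (p * (1 - (p + e)))) = e / (p * (1 - p))].
Proof.
move=> /andP[e0 e1].
pose g (p : R) := p * (1 - p) * ln (1 + e / (p * (1 - (p + e)))).
have arg_gt0 (p : R) : 0 < p -> p + e < 1 -> 0 < e / (p * (1 - (p + e))).
  by move=> p0 pe; rewrite divr_gt0// mulr_gt0//; lra.
suff [a [b [ab a0 b1 [ga gb]]]] : exists a b : R,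
    [/\ a <= b, 0 < a, b + e < 1 & g a <= e /\ e <= g b].
  have cg : {within `[a, b], continuous g}.
    apply: derivable_within_continuous => p; rewrite in_itv/= => /andP[ap pb].
    have p0 : 0 < p by lra.
    have q0 : 0 < 1 - (p + e) by lra.
    have pq0 : p * (1 - (p + e)) != 0 by rewrite gt_eqF// mulr_gt0.
    have lnpos : 0 < 1 + e / (p * (1 - (p + e))).
      by rewrite addr_gt0// arg_gt0//; lra.
    apply: ex_derive; rewrite /g; differentiate; reflexivity.
  have [|p] := @IVT R g a b e ab cg.
    by rewrite ge_min ga/= le_max gb orbT.
  rewrite in_itv/= => /andP[ap pb] gp.
  have p0 : 0 < p by lra.
  have p1 : p < 1 by lra.
  exists p; split => //; first by lra.
  have pn : p * (1 - p) != 0 by rewrite gt_eqF// mulr_gt0// subr_gt0.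
  by apply: (mulfI pn); rewrite [RHS]mulrCA mulfV// mulr1.
(* With 1 - (b + e) = h, the bound h <= e exp (- 2 / (1 - e)) makes the
   logarithm at least 2 / (1 - e), and h <= (1 - e) / 2 gives
   b >= (1 - e) / 2. *)
pose h := Num.min ((1 - e) / 2) (e * expR (- (2 / (1 - e)))).
have h0 : 0 < h.
  by rewrite lt_min divr_gt0 ?subr_gt0//= mulr_gt0 ?expR_gt0.
have h1 : h <= (1 - e) / 2 by rewrite ge_min lexx.
have h2 : h <= e * expR (- (2 / (1 - e))) by rewrite ge_min lexx orbT.
exists ((1 - e) / 2), (1 - e - h); split; [lra|lra|lra|split].
- set x := (1 + e) / (1 - e).
  have e1n : 1 - e != 0 by rewrite gt_eqF//; lra.
  have ep1n : 1 + e != 0 by rewrite gt_eqF//; lra.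
  have x1 : 1 <= x by rewrite /x ler_pdivlMr; lra.
  rewrite /g (_ : 1 + _ = x ^+ 2); last by rewrite /x; field.
  rewrite lnXn; last lra.
  have := ln_le_half_sub_inv x1; set l := ln x => hl.
  apply: (@le_trans _ _ ((1 - e) / 2 * (1 - (1 - e) / 2) * (x - x^-1))).
    rewrite ler_pM2l; last by rewrite mulr_gt0//; lra.
    rewrite mulr2n; lra.
  rewrite le_eqVlt; apply/orP; left; apply/eqP; rewrite /x; field.
  by apply/andP.
- set p := 1 - e - h.
  have p0 : (1 - e) / 2 <= p by rewrite /p; lra.
  have pe : 1 - (p + e) = h by rewrite /p; ring.
  have L : 2 / (1 - e) <= ln (1 + e / (p * (1 - (p + e)))).
    rewrite -[leLHS]expRK ler_ln ?posrE ?expR_gt0//; last first.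
      by rewrite addr_gt0// arg_gt0//; rewrite /p; lra.
    apply: (@le_trans _ _ (e / h)).
      rewrite ler_pdivlMr// mulrC -ler_pdivlMr ?expR_gt0// -expRN //.
    apply: (@le_trans _ _ (e / (p * (1 - (p + e))))); last by rewrite lerDr.
    rewrite pe ler_pM2l// lef_pV2 ?posrE//; last by rewrite mulr_gt0//; lra.
    rewrite ger_pMl//; rewrite /p; lra.
  rewrite /g.
  apply: (@le_trans _ _ (p * (1 - p) * (2 / (1 - e)))); last first.
    rewrite ler_pM2l// mulr_gt0//; rewrite /p in p0 *; lra.
  rewrite mulrA ler_pdivlMr; last lra.
  rewrite /p in p0 *; nra.
Qed.

(** The parameter c is the likelihood ratio (1 - q) / (1 - p) of the outcome 0
under the Bernoulli laws q = p + e and p.  At t = p the right-hand side is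
the relative entropy of q with respect to p, and the choice of p as a critical
point makes the tangent inequality of [bernoulli_fun_tangent] at
ln (1 + r / p), r = (1 - c) / c, say that this value is the minimum over t. *)
Lemma tilt_exponent (R : realType) (e : R) : 0 < e < 1 ->
  exists c : R, 0 < c < 1 /\ forall t : R, 0 < t ->
    2 * e ^+ 2 <= (1 - (t + e)) * ln c + (t + e) * ln (c + (1 - c) / t).
Proof.
move=> e01; have [p [p0 q1 sE]] := stationary_point_exists e01.
have /andP[e0 e1] := e01.
set q := p + e in q1 sE.
have q0 : 0 < 1 - q by lra.
have p1 : 0 < 1 - p by rewrite /q in q1; lra.
pose r := e / (1 - q).
have r0 : 0 < r by rewrite divr_gt0.
exists (1 + r)^-1; split.
  by rewrite invr_gt0 invf_lt1 ?posrE; lra.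
move=> t t0.
have lnrt (u : R) : 0 < u -> 0 < ln (1 + r / u).
  by move=> u0; rewrite ln_gt0// ltrDl divr_gt0.
have exprt (u : R) : 0 < u -> expR (ln (1 + r / u)) = 1 + r / u.
  by move=> u0; rewrite lnK// posrE addr_gt0// divr_gt0.
have -> : (1 + r)^-1 + (1 - (1 + r)^-1) / t = (1 + r)^-1 * (1 + r / t).
  by field; rewrite !gt_eqF//; lra.
rewrite lnM ?posrE ?invr_gt0; [|lra|by rewrite addr_gt0// divr_gt0].
rewrite lnV ?posrE; last lra.
have := bernoulli_fun_tangent (lnrt _ p0) (lnrt _ t0).
rewrite /bernoulli_fun /bernoulli_fun_deriv !exprt//.
have -> : 1 + r / p = 1 + e / (p * (1 - q)).
  by rewrite /r; field; rewrite !gt_eqF.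
move: sE (lnrt _ t0) => sE.
set s := ln (1 + r / t) => s0.
have ln1r : ln (1 + r) = ln (1 - p) - ln (1 - q).
  rewrite -ln_div ?posrE//; congr ln; rewrite /r /q in q0 *; field.
  by rewrite gt_eqF.
(* The abscissa of the point of tangency is the difference of the log-odds of q
   and p. *)
have s0E : ln (1 + e / (p * (1 - q))) = ln q - ln p + ln (1 - p) - ln (1 - q).
  have qp : 0 < q by rewrite addr_gt0.
  rewrite -!lnV -?lnM ?posrE ?invr_gt0 ?divr_gt0 ?mulr_gt0 ?invr_gt0//.
  congr ln; rewrite /q in q0 *; field; rewrite !gt_eqF//.
set s1 := ln (1 + e / (p * (1 - q))) in sE s0E *.
move=> tangent.
have pin : 2 * e ^+ 2 <= q * s1 - ln (1 + r).
  have pq : p <= q by rewrite /q; lra.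
  have := pinsker_bernoulli p0 pq q1.
  by rewrite (_ : q - p = e) ?ln1r ?s0E; [lra|rewrite /q; ring].
suff : q * s1 <= (t + e) * s by lra.
move: tangent.
have -> : s1 / (1 + e / (p * (1 - q)) - 1) = s1 * p / r.
  by rewrite /r; field; rewrite !gt_eqF.
have -> : s / (1 + r / t - 1) = s * t / r.
  by field; rewrite !gt_eqF.
have -> : (1 + e / (p * (1 - q)) - 1 - s1 * (1 + e / (p * (1 - q)))) /
    (1 + e / (p * (1 - q)) - 1) ^+ 2 = - e / r.
  by rewrite sE /r /q in q0 *; field; rewrite !gt_eqF.
rewrite [- e / r * _]mulrAC -mulrDl ler_pM2r ?invr_gt0//.
rewrite /q; lra.
Qed.

(** * A discrete Dvoretzky-Kiefer-Wolfowitz-Massart inequality *)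

Lemma tilt_exponentXn (R : realType) (m : nat) (e : R) :
  (0 < m)%N -> 0 < e < 1 ->
  exists c : R, 0 < c < 1 /\ forall j : nat, (j <= m)%N ->
    0 < j%:R / m%:R - e ->
    expR (2 * m%:R * e ^+ 2) <=
    (c + (1 - c) / (j%:R / m%:R - e)) ^+ j * c ^+ (m - j).
Proof.
move=> m0 /tilt_exponent[c [c01 cP]]; exists c; split=> // j jm.
set u := j%:R / m%:R - e => u0.
have /andP[c0 c1] := c01.
have A0 : 0 < c + (1 - c) / u by rewrite addr_gt0// divr_gt0// subr_gt0.
have mR : 0 < m%:R :> R by rewrite ltr0n.
rewrite -[leRHS]lnK ?posrE ?mulr_gt0 ?exprn_gt0// ler_expR.
rewrite lnM ?posrE ?exprn_gt0// !lnXn//.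
have := cP _ u0; rewrite (_ : u + e = j%:R / m%:R); last by rewrite /u subrK.
rewrite -(ler_pM2l mR) => /le_trans; rewrite -mulrA mulrCA; apply.
rewrite -[_ *+ j]mulr_natl -[_ *+ (m - j)]mulr_natl natrB//.
by rewrite le_eqVlt; apply/orP; left; apply/eqP; field; rewrite gt_eqF.
Qed.

(** Two product weights are compared on an event that depends only on the
coarsened coordinates s (f i): it suffices to compare the weights of the fibres
of the coarsening.  This replaces the optional stopping of a likelihood
ratio. *)
Lemma sum_coarsening_le (R : realFieldType) (I K : finType) (w q : I -> K -> R)
    (s : K -> K) (E : pred {ffun I -> K}) (L : R) :
  (forall f, E f = E [ffun i => s (f i)]) ->
  (forall f, E f ->
    L * \prod_i \sum_(b | s b == s (f i)) w i b <=
    \prod_i \sum_(b | s b == s (f i)) q i b) ->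
  L * \sum_(f | E f) \prod_i w i (f i) <= \sum_(f | E f) \prod_i q i (f i).
Proof.
move=> Es EL.
pose S (f : {ffun I -> K}) : {ffun I -> K} := [ffun i => s (f i)].
rewrite (partition_big S xpredT)//= [leRHS](partition_big S xpredT)//=.
rewrite mulr_sumr.
apply: ler_sum => g _.
have fiber (p : I -> K -> R) : (exists2 f, E f & S f = g) ->
    \sum_(f | E f && (S f == g)) \prod_i p i (f i) =
    \prod_i \sum_(b | s b == g i) p i b.
  move=> [f Ef fg].
  rewrite (bigA_distr_big_dep (fun i b => s b == g i)).
  apply: eq_bigl => h; apply/andP/familyP => /=.
    by move=> [_ /eqP hg] i; rewrite unfold_in -hg ffunE.
  move=> hg; have hS : S h = g.
    by apply/ffunP => i; rewrite ffunE; apply/eqP; have := hg i.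
  by rewrite hS eqxx Es -/(S h) hS -fg -Es.
have [/existsP[f /andP[Ef /eqP fg]]|noE] := boolP [exists f, E f && (S f == g)].
  have gE i : g i = s (f i) by rewrite -fg ffunE.
  rewrite !fiber; [|by exists f..].
  have := EL f Ef; under eq_bigr do under eq_bigl do rewrite -gE.
  by under [X in _ <= X -> _]eq_bigr do under eq_bigl do rewrite -gE.
by rewrite !big_pred0 ?mulr0// => f; apply/negbTE; move: noE;
  rewrite negb_exists => /forallP/(_ f).
Qed.

(** A configuration f puts the point i in the bin f i, where f i < j means that
the point lies below the j-th of m increasing thresholds.  When the thresholds
are scanned downwards, [last_crossed f j] is the event that j is the first
threshold with at least j points below it. *)
Section last_crossing.
Variable m : nat.
Implicit Types (f : {ffun 'I_m -> 'I_m.+1}) (j : 'I_m.+1).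

Definition crossed f j : bool :=
  (0 < j)%N && (j <= #|[set i | (f i < j)%N]%SET|)%N.

Definition last_crossed f j : bool :=
  crossed f j && [forall k : 'I_m.+1, (j < k)%N ==> ~~ crossed f k].

Lemma last_crossed_exists f : [exists j, crossed f j] ->
  exists j, last_crossed f j.
Proof.
move=> /existsP[j0 cj0].
case: (arg_maxnP (fun j : 'I_m.+1 => j : nat) cj0) => j cj jmax.
exists j; rewrite /last_crossed cj; apply/forallP => k; apply/implyP => jk.
by apply/negP => /jmax /=; rewrite leqNgt jk.
Qed.

Lemma last_crossed_inj f j k : last_crossed f j -> last_crossed f k -> j = k.
Proof.
move=> /andP[cj /forallP jmax] /andP[ck /forallP kmax]; apply: val_inj => /=.
have [jk|kj|//] := ltngtP j k.
  by move: (jmax k); rewrite jk ck.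
by move: (kmax j); rewrite kj cj.
Qed.

Definition merge_below j (b : 'I_m.+1) : 'I_m.+1 :=
  if (b < j)%N then ord0 else b.

(** The scan stops at j without having distinguished the bins below j. *)
Lemma last_crossed_merge j f :
  last_crossed f j = last_crossed [ffun i => merge_below j (f i)] j.
Proof.
case: (posnP j) => [j0|jgt0].
  by rewrite /last_crossed /crossed j0.
have ck (k : 'I_m.+1) : (j <= k)%N ->
    crossed [ffun i => merge_below j (f i)] k = crossed f k.
  move=> jk; rewrite /crossed; congr (_ && (_ <= _)%N); apply: eq_card => i.
  rewrite !inE ffunE /merge_below.
  case: (ltnP (f i) j) => // fij /=.
  by rewrite (leq_trans jgt0 jk) (leq_trans fij jk).
rewrite /last_crossed ck//; congr (_ && _); apply: eq_forallb => k.
by case: (ltnP j k) => //= /ltnW jk; rewrite ck.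
Qed.

Lemma sum_merge_below (R : realFieldType) (p : 'I_m.+1 -> R) j b : (0 < j)%N ->
  \sum_(a | merge_below j a == merge_below j b) p a =
  if (b < j)%N then \sum_(a : 'I_m.+1 | (a < j)%N) p a else p b.
Proof.
move=> j0; rewrite {2}/merge_below; case: (ltnP b j) => bj.
  apply: eq_bigl => a; rewrite /merge_below; case: (ltnP a j) => aj.
    by rewrite ?eqxx.
  by apply/negbTE; rewrite -val_eqE/= -lt0n (leq_trans j0).
apply: big_pred1 => a; rewrite /merge_below; case: (ltnP a j) => //= aj.
have -> : (a == b) = false.
  by apply/negbTE; rewrite -val_eqE/= neq_ltn (leq_trans aj bj).
by apply/negbTE; rewrite -val_eqE/= eq_sym -lt0n (leq_trans j0).
Qed.

(** The Chernoff-type bound behind the inequality: the weights w are tilted to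
q = c w + (1 - c) delta_0.  Splitting according to the last crossing j, the
merged bin {b < j} has weight v <= u = j / m - e under w i and
c v + (1 - c) >= (c + (1 - c) / u) v under q i, while the other bins keep the
factor c. *)
Theorem sum_crossed_le (R : realType) (w : 'I_m -> 'I_m.+1 -> R) (e : R) :
  0 < e ->
  (forall i b, 0 <= w i b) -> (forall i, \sum_b w i b = 1) ->
  (forall i j, \sum_(b : 'I_m.+1 | (b < j)%N) w i b <=
    Num.max 0 (j%:R / m%:R - e)) ->
  \sum_(f | [exists j, crossed f j]) \prod_i w i (f i) <=
  expR (- (2 * m%:R * e ^+ 2)).
Proof.
move=> e0 w0 w1 wu.
case: (posnP m) => [m_eq0|m0].
  rewrite big_pred0 ?expR_ge0// => f; apply/negbTE/existsPn => j.
  rewrite /crossed lt0n; move: (ltn_ord j).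
  by rewrite ltnS {2}m_eq0 leqn0 => ->.
have mR : 0 < m%:R :> R by rewrite ltr0n.
have v0 i j : 0 <= \sum_(b : 'I_m.+1 | (b < j)%N) w i b by apply: sumr_ge0.
have jm j : (j%:R : R) / m%:R <= 1.
  by rewrite ler_pdivrMr// mul1r ler_nat -ltnS.
have [c [c0 c1 cP]] : exists c : R, [/\ 0 < c, c < 1 & forall j,
    0 < j%:R / m%:R - e -> expR (2 * m%:R * e ^+ 2) <=
    (c + (1 - c) / (j%:R / m%:R - e)) ^+ j * c ^+ (m - j)].
  have [e1|e1] := ltP e 1; last first.
    (* All thresholds are then nonpositive, and any c does. *)
    exists (1 / 2); split; [lra|lra|move=> j u0; exfalso].
    by have := jm j; lra.
  have [|c [/andP[c0 c1] cP]] := @tilt_exponentXn R m e m0; first by rewrite e0.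
  by exists c; split => // j u0; apply: cP => //; rewrite -ltnS.
rewrite expRN -[leRHS]mul1r ler_pdivlMr ?expR_gt0// mulrC.
set L := expR _.
pose q i b := c * w i b + (1 - c) * (b == ord0 :> 'I_m.+1)%:R.
have q0 i b : 0 <= q i b.
  by rewrite addr_ge0// mulr_ge0 ?ler0n ?subr_ge0// ltW.
have q1 : \sum_(f : {ffun 'I_m -> 'I_m.+1}) \prod_i q i (f i) = 1.
  rewrite -(bigA_distr_bigA q) big1// => i _.
  rewrite /q big_split/= -!mulr_sumr w1 mulr1 (bigD1 ord0)//= big1 ?addr0.
    by rewrite ?eqxx mulr1 addrC subrK.
  by move=> b /negbTE ->.
pose G f : R := \prod_i w i (f i); pose H f : R := \prod_i q i (f i).
have G0 f : 0 <= G f by apply: prodr_ge0.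
have H0 f : 0 <= H f by apply: prodr_ge0.
apply: (@le_trans _ _ (L * \sum_j \sum_(f | last_crossed f j) G f)).
  rewrite ler_pM2l ?expR_gt0// (exchange_big_dep predT)//=.
  rewrite big_mkcond/=; apply: ler_sum => f _.
  case: ifPn => [/last_crossed_exists[j fj]|_]; last exact: sumr_ge0.
  by rewrite (bigD1 j)//= lerDl sumr_ge0.
apply: (@le_trans _ _ (\sum_j \sum_(f | last_crossed f j) H f)); last first.
  rewrite -q1 (exchange_big_dep predT)//=; apply: ler_sum => f _.
  have [/existsP[j fj]|nof] := boolP [exists j, last_crossed f j].
    rewrite (big_pred1 j)// => k; apply/idP/eqP => [|->//].
    by move/last_crossed_inj; apply.
  rewrite big_pred0 ?H0// => j; apply/negbTE.
  by move: nof; rewrite negb_exists => /forallP.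
rewrite mulr_sumr; apply: ler_sum => j _.
apply: (@sum_coarsening_le R _ _ w q (merge_below j)) => f.
  exact: last_crossed_merge.
move=> /andP[/andP[j0 jN] _].
under eq_bigr do rewrite sum_merge_below//.
under [X in _ <= X]eq_bigr do rewrite sum_merge_below//.
set u := j%:R / m%:R - e.
pose B := [set i | (f i < j)%N]%SET.
(* Nothing lies below a nonpositive threshold, yet j > 0 points are crossed. *)
have [u0|u0] := leP u 0.
  have [i iB] : exists i, i \in B by apply/card_gt0P; apply: leq_trans jN.
  rewrite (bigD1 i)//=; rewrite inE in iB; rewrite iB.
  have -> : \sum_(a : 'I_m.+1 | (a < j)%N) w i a = 0.
    apply/eqP; rewrite eq_le v0 andbT (le_trans (wu i j))//.
    by rewrite ge_max lexx.
  rewrite mul0r mulr0; apply: prodr_ge0 => k _.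
  by case: ifP => _ //; apply: sumr_ge0.
set A := c + (1 - c) / u.
have cA1 : 1 <= A.
  have : 1 - c <= (1 - c) / u.
    by rewrite ler_pdivlMr// ger_pMr ?subr_gt0//; have := jm j; rewrite /u; lra.
  rewrite /A; lra.
have Bm : (#|B| <= m)%N by have := max_card (mem B); rewrite card_ord.
have AL : L <= \prod_i (if (f i < j)%N then A else c).
  have -> : \prod_i (if (f i < j)%N then A else c) =
      A ^+ #|B| * c ^+ (m - #|B|).
    rewrite (bigID (mem B))/=; congr (_ * _).
      by under eq_bigr => i do [rewrite inE => ->]; rewrite prodr_const.
    under eq_bigr => i do [rewrite inE => /negbTE ->].
    rewrite prodr_const; congr (_ ^+ _).
    have := cardC (mem B); rewrite card_ord => BC.
    by apply/eqP; rewrite -(eqn_add2l #|B|) subnKC// BC.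
  apply: (le_trans (cP j u0)); apply: ler_pM.
  - by rewrite exprn_ge0// (le_trans _ cA1).
  - by rewrite exprn_ge0// ltW.
  - by rewrite ler_weXn2l.
  - by rewrite ler_wiXn2l ?leq_sub2l// ltW.
apply: (@le_trans _ _ ((\prod_i (if (f i < j)%N then A else c)) *
    \prod_i (if (f i < j)%N then \sum_(a : 'I_m.+1 | (a < j)%N) w i a
             else w i (f i)))).
  rewrite ler_wpM2r//; apply: prodr_ge0 => i _.
  by case: ifP => _ //; apply: sumr_ge0.
rewrite -big_split/=; apply: ler_prod => i _.
case: ltnP => fij; last first.
  rewrite mulr_ge0//=; last exact: ltW.
  by rewrite /q lerDl mulr_ge0 ?ler0n ?subr_ge0// ltW.
rewrite mulr_ge0 ?v0 ?(le_trans _ cA1)//=.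
have mass0 : \sum_(b : 'I_m.+1 | (b < j)%N) (b == ord0)%:R = 1 :> R.
  by rewrite (bigD1 ord0)//= big1 ?addr0// => b /andP[_ /negbTE ->].
rewrite /q big_split/= -!mulr_sumr mass0.
set v := \sum_(a | _) _.
have vu : v <= u by have := wu i j; rewrite -/u (max_idPr (ltW u0)).
rewrite /A mulrDl lerD2l mulr1 mulrAC ler_pdivrMr// ler_pM2l//.
by rewrite subr_gt0.
Qed.

End last_crossing.

(** * The inequality for independent random variables *)

Lemma measurable_finite_pattern d (T : measurableType d) (I : finType)
    (A : T -> pred I) (Phi : pred {set I}) :
  (forall i, measurable [set t | A t i]) ->
  measurable [set t | Phi [set i | A t i]%SET].
Proof.
move=> mA.
have -> : [set t | Phi [set i | A t i]%SET] =
    \bigcup_(S in [set S : {set I} | Phi S]) \bigcap_(i in [set: I])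
      (if i \in S then [set t | A t i] else ~` [set t | A t i]).
  apply/seteqP; split=> t /=.
    move=> PhiA; exists [set i | A t i]%SET => //= i _.
    by rewrite inE; case: ifPn => // /negP.
  move=> [S PhiS AS]; suff -> : [set i | A t i]%SET = S by [].
  apply/setP => i; rewrite inE; have := AS i Logic.I; case: ifP => //= _.
  by move=> /negP/negbTE.
apply: fin_bigcup_measurable; first exact: finite_finset.
move=> S _; apply: fin_bigcap_measurable; first exact: finite_finset.
by move=> i _; case: ifP => _; [|exact: measurableC].
Qed.

Lemma measurable_exists_fin d (T : measurableType d) (I : finType)
    (A : T -> pred I) :
  (forall i, measurable [set t | A t i]) ->
  measurable [set t | [exists i, A t i]].
Proof.
move=> mA; rewrite [X in measurable X](_ : _ = \bigcup_i [set t | A t i]).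
  by apply: fin_bigcup_measurable => //; exact: finite_finset.
apply/seteqP; split=> t /=; first by move=> /existsP[i]; exists i.
by move=> [i _ Ai]; apply/existsP; exists i.
Qed.

Lemma measure_bigcup_fin_le d (T : measurableType d) (R : realType)
    (mu : {measure set T -> \bar R}) (I : finType) (D : pred I)
    (F : I -> set T) :
  (forall i, measurable (F i)) ->
  (mu (\bigcup_(i in [set` D]) F i) <= \sum_(i | D i) mu (F i))%E.
Proof.
move=> mF; rewrite bigcup_pred.
apply: (@proj2 (measurable (\big[setU/set0]_(i in D) F i))).
apply: (big_ind2 (fun A x => measurable A /\ (mu A <= x)%E)) => //.
  by rewrite measure0.
move=> A x B y [mA Ax] [mB By]; split; first exact: measurableU.
apply: le_trans (leeD Ax By); exact: measureU2.
Qed.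

Lemma mutually_independent_enum_val d (T : measurableType d) (R : realType)
    (P : probability T R) (n : nat) (Y : 'I_n -> {RV P >-> R})
    (G : {set 'I_n}) :
  mutually_independent Y ->
  mutually_independent (fun i : 'I_#|G| => Y (enum_val i)).
Proof.
move=> indep J B mB.
have [G0|[x0 Gx0]] := set_0Vmem G.
  have noI : 'I_#|G| -> False by rewrite G0 cards0 => -[].
  have := indep finset.set0 (fun=> setT) (fun=> measurableT).
  rewrite !big_pred0; first last.
  - by move=> i; rewrite !inE.
  - by move=> i; exfalso; exact: (noI i).
  move=> <-; congr (P _); apply/seteqP; split=> t _ i; rewrite /= ?inE//.
have := indep (enum_val @: J)%SET (fun i => B (enum_rank_in Gx0 i))
  (fun=> mB _).
rewrite big_imset/=; last by move=> i j _ _; exact: enum_val_inj.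
under eq_bigr do rewrite enum_valK_in.
move=> <-; congr (P _); apply/seteqP; split=> t tB i /= iJ.
  by move/imsetP: iJ => [k kJ ->]; rewrite /= enum_valK_in; exact: tB.
have := tB (enum_val i); rewrite /= enum_valK_in; apply.
exact: imset_f.
Qed.

(** When the z i are nonnegative and H is their empirical c.d.f., this says that
H x - x > e for some x >= 0; the condition is spelled out for each of the
finitely many positive values j / m of H. *)
Definition exceeds_band (R : realType) (m : nat) (z : 'I_m -> R) (e : R) :
    bool :=
  [exists j : 'I_m.+1, (0 < j)%N &&
     (j <= #|[set i | (z i < j%:R / m%:R - e)%R]%SET|)%N].

Lemma measurable_exceeds_band d (T : measurableType d) (R : realType) (m : nat)
    (Z : 'I_m -> T -> R) (e : R) :
  (forall i, measurable_fun setT (Z i)) ->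
  measurable [set t | exceeds_band (Z^~ t) e].
Proof.
move=> mZ; apply: measurable_exists_fin => j.
apply: (@measurable_finite_pattern _ _ _
  (fun t (i : 'I_m) => Z i t < j%:R / m%:R - e)
  (fun S => (0 < j)%N && (j <= #|S|)%N)) => i.
have := mZ i measurableT _ (measurable_itv `]-oo, j%:R / m%:R - e[).
by rewrite setTI; congr measurable; apply/seteqP; split=> t /=; rewrite in_itv.
Qed.

(** The event depends only on the position of each z (Y i) among the thresholds
u j = j / m - e, so the statement reduces to the law of these positions. *)
Theorem superuniform_exceeds_band_le d (T : measurableType d) (R : realType)
    (P : probability T R) (m : nat) (Y : 'I_m -> {RV P >-> R})
    (z : R -> R) (e : R) :
  mutually_independent Y -> 0 < e -> measurable_fun setT z ->
  (forall i (u : R), P (Y i @^-1` [set x | z x < u]%R) <=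
    (Num.max 0%R u)%:E)%E ->
  (P [set t | exceeds_band (fun i => z (Y i t)) e] <=
   (expR (- (2 * m%:R * e ^+ 2)))%:E)%E.
Proof.
move=> indep e0 mz superunif.
pose u (j : nat) : R := j%:R / m%:R - e.
have um j k : (j <= k)%N -> u j <= u k.
  move=> jk; rewrite /u lerD2r ler_wpM2r ?invr_ge0//.
  by rewrite ler_nat.
(* The bin of x is the number of the last threshold not above z x. *)
pose bin_of (S : {set 'I_m.+1}) : nat := \max_(k : 'I_m.+1 | k \in S) k.
have bin_lt (S : {set 'I_m.+1}) : (bin_of S < m.+1)%N.
  by rewrite ltnS; apply/bigmax_leqP => k _; rewrite -ltnS.
pose S (x : R) := [set k : 'I_m.+1 | (0 < k)%N && (u k <= z x)]%SET.
pose bin (x : R) : 'I_m.+1 := Ordinal (bin_lt (S x)).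
have binP (x : R) (j : 'I_m.+1) : (0 < j)%N -> (bin x < j)%N = (z x < u j).
  move=> j0; apply/idP/idP => [xj|zj].
    rewrite ltNge; apply/negP => uz; move: xj; rewrite ltnNge => /negP; apply.
    have jS : j \in S x by rewrite inE j0.
    exact: (@leq_bigmax_cond _ (mem (S x)) (fun k : 'I_m.+1 => k : nat) j jS).
  rewrite -(prednK j0) ltnS; apply/bigmax_leqP => k.
  rewrite inE => /andP[k0 uk].
  rewrite -ltnS (prednK j0) ltnNge; apply/negP => jk.
  by have := um _ _ jk; rewrite leNgt (le_lt_trans uk zj).
pose B (b : 'I_m.+1) : set R := [set x | bin x == b].
have mz_ge (r : R) : measurable [set x | r <= z x].
  rewrite [X in measurable X](_ : _ = z @^-1` `[r, +oo[%classic).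
    by rewrite -[X in measurable X]setTI; exact: mz.
  by apply/seteqP; split=> x /=; rewrite in_itv/= andbT.
have mB b : measurable (B b).
  apply: (@measurable_finite_pattern _ _ _
    (fun x (k : 'I_m.+1) => (0 < k)%N && (u k <= z x))
    (fun S => Ordinal (bin_lt S) == b)).
  move=> k; case: (ltnP 0 k) => k0 /=; first exact: mz_ge.
  rewrite [X in measurable X](_ : _ = set0); first exact: measurable0.
  by apply/seteqP; split.
have mYB i b : measurable (Y i @^-1` B b).
  by rewrite -[X in measurable X]setTI; exact: measurable_funP.
pose w (i : 'I_m) (b : 'I_m.+1) : R := fine (P (Y i @^-1` B b)).
have PE i b : P (Y i @^-1` B b) = (w i b)%:E.
  by rewrite /w fineK// fin_num_measure.
have w0 i b : 0 <= w i b by rewrite -lee_fin -PE.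
have sumw (D : {pred 'I_m.+1}) i :
    (\sum_(b | D b) w i b)%:E = P (Y i @^-1` [set x | D (bin x)]).
  rewrite -sumEFin; under eq_bigr do rewrite -PE.
  rewrite -measure_bigsetU_ord//; last first.
    by move=> b c _ _ [t [/= /eqP <- /eqP]].
  congr (P _); rewrite -bigcup_pred; apply/seteqP; split=> t /=.
    by move=> [b Db /eqP ->].
  by move=> Dt; exists (bin (Y i t)); [exact: Dt|exact: eqxx].
have w1 i : \sum_b w i b = 1.
  apply: EFin_inj; rewrite (sumw xpredT) -(probability_setT P); congr (P _).
  by apply/seteqP; split.
have wu i (j : 'I_m.+1) :
    \sum_(b : 'I_m.+1 | (b < j)%N) w i b <= Num.max 0 (j%:R / m%:R - e).
  have [j0|j0] := posnP j.
    by rewrite big_pred0 ?le_max ?lexx// => b; rewrite j0.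
  rewrite -lee_fin (sumw (fun b : 'I_m.+1 => (b < j)%N)).
  apply: le_trans (superunif i _); rewrite le_eqVlt; apply/orP; left.
  apply/eqP; congr (P _); apply/seteqP; split=> t /=; rewrite binP//.
have := sum_crossed_le e0 w0 w1 wu.
rewrite -lee_fin; apply: le_trans.
rewrite -sumEFin.
under eq_bigr => f _.
  rewrite -prodEFin.
  under eq_bigr do rewrite -PE.
  over.
under eq_bigr => f _.
  rewrite (_ : (\prod_(i : 'I_m) P (Y i @^-1` B (f i)))%E =
    P (\bigcap_(i in [set` [set: 'I_m]%SET]) (Y i @^-1` B (f i)))); last first.
    rewrite (indep _ (fun i => B (f i)))//.
    by apply: eq_bigl => i; rewrite inE.
  over.
have mcell (f : {ffun 'I_m -> 'I_m.+1}) :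
    measurable (\bigcap_(i in [set` [set: 'I_m]%SET]) (Y i @^-1` B (f i))).
  by apply: fin_bigcap_measurable => //; exact: finite_finset.
apply: le_trans (measure_bigcup_fin_le P
  (fun f : {ffun 'I_m -> 'I_m.+1} => [exists j, crossed f j]) mcell).
rewrite le_measure ?inE//.
- apply: (@measurable_exceeds_band _ _ _ _ (fun i => z \o Y i)) => i.
  by apply: measurableT_comp mz _; exact: measurable_funP.
- apply: fin_bigcup_measurable => //; exact: finite_finset.
- move=> t /= /existsP[j /andP[j0 jle]].
  exists [ffun i => bin (Y i t)].
    apply/existsP; exists j; rewrite /crossed j0 (leq_trans jle)//.
    by apply/subset_leq_card/fintype.subsetP => i; rewrite !inE ffunE binP.
  by move=> i _; rewrite /= /B /= ffunE.
Qed.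

(** * Superuniformity of the probability integral transforms *)

(** The finite unions of a chain belong to the chain, and the measure is
continuous along their increasing sequence. *)
Lemma measure_bigcup_chain_le d (T : measurableType d) (R : realType)
    (mu : {measure set T -> \bar R}) (A : nat -> set T) (b : \bar R) :
  (forall n, measurable (A n)) ->
  (forall i j, A i `<=` A j \/ A j `<=` A i) ->
  (forall n, mu (A n) <= b)%E -> (mu (\bigcup_n A n) <= b)%E.
Proof.
move=> mA chain Ab.
pose F n := \big[setU/set0]_(i < n.+1) A i.
have mF n : measurable (F n) by apply: bigsetU_measurable.
have ndF : nondecreasing_seq F.
  by move=> i j ij; apply/subsetPset; apply: subset_bigsetU.
have FA n : exists i, F n = A i.
  elim: n => [|n [i Fi]]; first by exists 0%N; rewrite /F big_ord1.
  rewrite /F big_ord_recr/= -/(F n) Fi.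
  have [ij|ji] := chain i n.+1.
    by exists n.+1; exact/setUidPr.
  by exists i; exact/setUidPl.
rewrite -bigcup_bigsetU_bigcup.
have cF := @nondecreasing_cvg_mu _ _ _ mu _ mF
  (bigcup_measurable (fun k _ => mF k)) ndF.
rewrite -(cvg_lim _ cF)//; apply: lime_le.
  by apply/cvg_ex; eexists; exact: cF.
by apply: nearW => n /=; have [i ->] := FA n.
Qed.

Lemma measure_bigcup_count_chain_le d (T : measurableType d) (R : realType)
    (mu : {measure set T -> \bar R}) (K : countType) (D : {pred K})
    (A : K -> set T) (b : \bar R) :
  (forall q, measurable (A q)) ->
  (forall p q, A p `<=` A q \/ A q `<=` A p) ->
  (0 <= b)%E -> (forall q, q \in D -> mu (A q) <= b)%E ->
  (mu (\bigcup_(q in [set` D]) A q) <= b)%E.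
Proof.
move=> mA chain b0 Ab.
pose F n :=
  if @unpickle K n is Some q then if q \in D then A q else set0 else set0.
have -> : \bigcup_(q in [set` D]) A q = \bigcup_n F n.
  apply/seteqP; split=> t /=.
    by move=> [q Dq Aq]; exists (pickle q) => //; rewrite /F pickleK Dq.
  move=> [n _]; rewrite /F; case: unpickle => // q.
  by case: ifPn => // Dq Aq; exists q.
apply: measure_bigcup_chain_le => [n|i j|n]; rewrite /F.
- by case: unpickle => // q; case: ifP.
- case: (unpickle i) => [p|]; case: (unpickle j) => [q|]; try by [left|right].
  by case: ifP => _; case: ifP => _; by [|left|right].
- case: unpickle => [q|]; rewrite ?measure0//.
  by case: ifP => [/Ab//|_]; rewrite measure0.
Qed.

Section cdf_facts.
Context {R : realType} (F0 : cdf_on R).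

Definition left_lim (r : R) : R := lim (F0 x @[x --> r^'-]).

Lemma cdf_mono : {homo F0 : x y / x <= y}.
Proof. exact: (cumulative_is_nondecreasing F0). Qed.

Lemma cdf_on_le1 (x : R) : F0 x <= 1.
Proof.
rewrite leNgt; apply/negP => x1; near (pinfty_nbhs R) => y.
have : F0 x <= F0 y.
  by apply: cdf_mono; near: y; apply: nbhs_pinfty_ge; exact: num_real.
rewrite leNgt => /negP; apply; near: y.
by apply: cvgr_lt x1; exact: cumulativey.
Unshelve. all: by end_near. Qed.

Lemma cdf_on_ge0 (x : R) : 0 <= F0 x.
Proof.
rewrite leNgt; apply/negP => x0; near (ninfty_nbhs R) => y.
have : F0 y <= F0 x.
  by apply: cdf_mono; near: y; apply: nbhs_ninfty_le; exact: num_real.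
rewrite leNgt => /negP; apply; near: y.
by apply: cvgr_gt x0; exact: cumulativeNy.
Unshelve. all: by end_near. Qed.

Lemma cvg_left_lim (r : R) : F0 x @[x --> r^'-] --> left_lim r.
Proof.
apply: (@nondecreasing_at_left_is_cvgr R F0 r).
  by near=> x => y z _ _; exact: cdf_mono.
near=> x; exists 1 => _ [y _ <-]; exact: cdf_on_le1.
Unshelve. all: by end_near. Qed.

Lemma left_lim_le (r : R) : left_lim r <= F0 r.
Proof.
apply: (cvgr_to_le (@cvg_left_lim r)).
by near=> y; apply: cdf_mono.
Unshelve. all: by end_near. Qed.

Lemma le_left_lim (z r : R) : z < r -> F0 z <= left_lim r.
Proof.
move=> zr; apply: (cvgr_to_ge (@cvg_left_lim r)).
by near=> y; apply: cdf_mono; near: y; exact: nbhs_left_ge.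
Unshelve. all: by end_near. Qed.

Lemma lt_left_lim (w r : R) : w < left_lim r -> exists2 z, z < r & w < F0 z.
Proof.
move=> wr; near (r^'-) => y; exists y; first by near: y; exact: nbhs_left_lt.
by near: y; apply: cvgr_gt wr; exact: cvg_left_lim.
Unshelve. all: by end_near. Qed.

Lemma left_lim_mono : {homo left_lim : x y / x <= y}.
Proof.
move=> x y; rewrite le_eqVlt => /predU1P[->//|xy].
by rewrite (le_trans (left_lim_le x))// le_left_lim.
Qed.

Lemma left_lim_ge0 (r : R) : 0 <= left_lim r.
Proof.
by rewrite (le_trans (cdf_on_ge0 (r - 1)))// le_left_lim// ltrBlDr ltrDl.
Qed.

Lemma lt_cdf_right (x u : R) : F0 x < u -> exists2 z, x < z & F0 z < u.
Proof.
move=> xu; near (x^'+) => y; exists y; first by near: y; exact: nbhs_right_gt.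
by near: y; apply: cvgr_lt xu; exact: cumulative_is_right_continuous.
Unshelve. all: by end_near. Qed.

End cdf_facts.

Section superuniform.
Context d (T : measurableType d) {R : realType} (P : probability T R)
  (X : {RV P >-> R}) (F0 : cdf_on R).
Hypothesis XF : cdf X = EFin \o F0.

Let mray (i : interval R) : measurable (X @^-1` [set` i]).
Proof. by rewrite -[Y in measurable Y]setTI; exact: measurable_funP. Qed.

(** By right-continuity, F0 x < u iff F0 q < u for some rational q > x, so the
event is the union of the chain of events X <= q, whose probabilities F0 q are
less than u. *)
Lemma cdf_superuniform (u : R) :
  (P (X @^-1` [set x | F0 x < u]%R) <= (Num.max 0%R u)%:E)%E.
Proof.
have -> : X @^-1` [set x | F0 x < u] =
    \bigcup_(q in [set` (fun q : rat => F0 (ratr q) < u)])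
      X @^-1` `]-oo, (ratr q : R)].
  apply/seteqP; split=> t /=.
    move=> /lt_cdf_right[z xz zu].
    have [q] := rat_in_itvoo xz; rewrite in_itv/= => /andP[xq qz].
    exists q; last by rewrite /= in_itv/= ltW.
    by apply: le_lt_trans zu; apply: cdf_mono; exact: ltW.
  move=> [q /= qu]; rewrite in_itv/= => xq.
  by rewrite unfold_in in qu; apply: le_lt_trans qu; exact: cdf_mono.
apply: measure_bigcup_count_chain_le => [q|p q||q qu].
- exact: mray.
- have [pq|qp] := leP (ratr p : R) (ratr q).
    by left=> t /=; rewrite !in_itv/= => /le_trans; apply.
  by right=> t /=; rewrite !in_itv/= => /le_trans; apply; exact: ltW.
- by rewrite lee_fin le_max lexx.
- have := congr1 (fun f => f (ratr q)) XF.
  rewrite /cdf /distribution /pushforward /= => ->.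
  by rewrite unfold_in in qu; rewrite lee_fin le_max (ltW qu) orbT.
Qed.

(** Dually, F0 (x^-) > 1 - u iff F0 q > 1 - u for some rational q < x, and the
events X > q have probability 1 - F0 q < u. *)
Lemma ccdf_superuniform (u : R) :
  (P (X @^-1` [set x | 1 - left_lim F0 x < u]%R) <= (Num.max 0%R u)%:E)%E.
Proof.
have -> : X @^-1` [set x | 1 - left_lim F0 x < u] =
    \bigcup_(q in [set` (fun q : rat => 1 - F0 (ratr q) < u)])
      X @^-1` `](ratr q : R), +oo[.
  apply/seteqP; split=> t /=.
    rewrite ltrBlDr -ltrBlDl => /lt_left_lim[z zx zu].
    have [q] := rat_in_itvoo zx; rewrite in_itv/= => /andP[zq qx].
    exists q; last by rewrite /= in_itv/= andbT.
    have := cdf_mono F0 (ltW zq); rewrite /= unfold_in; lra.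
  move=> [q /= qu]; rewrite in_itv/= andbT => qx.
  have := le_left_lim F0 qx; rewrite unfold_in in qu; lra.
apply: measure_bigcup_count_chain_le => [q|p q||q qu].
- exact: mray.
- have [pq|qp] := leP (ratr p : R) (ratr q).
    by right=> t /=; rewrite !in_itv/= !andbT; exact: le_lt_trans.
  by left=> t /=; rewrite !in_itv/= !andbT; apply: le_lt_trans; exact: ltW.
- by rewrite lee_fin le_max lexx.
- have PX := congr1 (fun f => f (ratr q)) XF.
  have -> : X @^-1` `](ratr q : R), +oo[ = ~` (X @^-1` `]-oo, (ratr q : R)]).
    apply/seteqP; split=> t /=; rewrite !in_itv/= andbT ltNge => /negP; exact.
  have PC := probability_setC P (mray `]-oo, (ratr q : R)]).
  rewrite /cdf /distribution /pushforward /= in PX; rewrite PX in PC.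
  rewrite [X in (X <= _)%E](_ : _ = (1 - (F0 (ratr q))%:E)%E); last exact: PC.
  by rewrite unfold_in in qu; rewrite -EFinB lee_fin le_max (ltW qu) orbT.
Qed.

End superuniform.

(** * Order statistics and the confidence region *)

Section order_statistics.
Variables (R : realType) (n : nat) (y : 'I_n -> R).

Let s := sort <=%R [seq y i | i <- enum 'I_n].

Let size_s : size s = n.
Proof. by rewrite size_sort size_map size_enum_ord. Qed.

Let sorted_s : sorted <=%R s.
Proof. by apply: sort_sorted; exact: le_total. Qed.

Let count_s (p : pred R) : count p s = #|[set i | p (y i)]%SET|.
Proof.
rewrite /s count_sort count_map cardE [in RHS]/enum_mem size_filter enumT.
by apply: eq_count => i; rewrite !inE.
Qed.

(** The index is shifted: this is Y_(l + 1). *)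
Definition order_stat_real (l : nat) : R := nth 0 s l.

Lemma order_statS (l : nat) : (l < n)%N ->
  order_stat y l.+1 = (order_stat_real l)%:E.
Proof. by move=> ln; rewrite /order_stat /= (nth_map 0) ?size_s. Qed.

Lemma order_stat_top : order_stat y n.+1 = +oo%E.
Proof. by rewrite /order_stat /= nth_default// size_map size_s. Qed.

Lemma order_stat_real_le (l : nat) (r : R) : (l < n)%N ->
  (order_stat_real l <= r) = (l < #|[set i | (y i <= r)%R]%SET|)%N.
Proof.
move=> ln; rewrite -(count_s (fun x => x <= r)).
apply/idP/idP => [|h]; last exact: nth_count_le.
apply: contraTT; rewrite -leqNgt -ltNge => h.
by apply: nth_count_gt => //; rewrite h size_s.
Qed.

Lemma order_stat_card_le (l : nat) : (l <= n)%N ->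
  (l <= #|[set i | ((y i)%:E <= order_stat y l)%E]%SET|)%N.
Proof.
case: l => // l ln; rewrite order_statS//.
under eq_finset do rewrite lee_fin.
by rewrite -order_stat_real_le.
Qed.

Lemma order_stat_card_lt (l : nat) : (l <= n)%N ->
  (#|[set i | ((y i)%:E < order_stat y l.+1)%E]%SET| <= l)%N.
Proof.
rewrite leq_eqVlt => /predU1P[->|ln].
  by rewrite -[X in (_ <= X)%N]card_ord max_card.
rewrite order_statS//; under eq_finset do rewrite lte_fin.
rewrite -(count_s (fun x => x < order_stat_real l)) leqNgt; apply/negP => h.
by have := nth_count_lt 0 sorted_s h; rewrite ltxx.
Qed.

Lemma order_stat_le (l l' : nat) : (l <= l')%N -> (l' <= n)%N ->
  (order_stat y l <= order_stat y l'.+1)%E.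
Proof.
move=> ll' l'n; case: l ll' => [|l] ll'; first exact: leNye.
move: l'n; rewrite leq_eqVlt => /predU1P[->|l'n].
  by rewrite order_stat_top leey.
rewrite !order_statS ?(leq_trans ll' (ltnW l'n))// lee_fin.
apply: (sorted_leq_nth le_trans lexx) => //; rewrite ?inE ?size_s//.
  exact: leq_trans ll' (ltnW l'n).
exact: ltnW.
Qed.

End order_statistics.

(** The hypotheses [dev_up] and [dev_down] bound the weighted empirical process
of the observations in G, each of weight theta; theta is chosen so that their
total weight is n - k. *)
Section confidence_region_of_uniform_deviation.
Variables (R : realType) (n : nat) (k alpha : R) (y : 'I_n -> R).
Variable F0 : cdf_on R.
Variable G : {set 'I_n}.
Hypothesis n0 : (0 < n)%N.
Hypothesis kn : 0 <= k < n%:R.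
Hypothesis kG : n%:R - k <= #|G|%:R.

Let lower (x : \bar R) : {set 'I_n} := [set i | ((y i)%:E <= x)%E]%SET.
Let slower (x : \bar R) : {set 'I_n} := [set i | ((y i)%:E < x)%E]%SET.

Let theta : R := (n%:R - k) / #|G|%:R.
Let c : R := c_ n k alpha.

Hypothesis dev_up : forall x : \bar R,
  theta * #|lower x :&: G|%:R / n%:R - (1 - k / n%:R) * cdf_ext F0 x <= c.
Hypothesis dev_down : forall x : \bar R,
  - c <= theta * #|slower x :&: G|%:R / n%:R -
    (1 - k / n%:R) * cdf_ext_left F0 x.

(** The part of the empirical measure left over by the weighted sample in G.  It
is monotone in S with values in [0, k], so the values that it takes at the order
statistics separate the lower bounds from the upper ones. *)
Let weight (S : {set 'I_n}) : R := \sum_(i in S) (1 - theta * (i \in G)%:R).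

Let nR : 0 < n%:R :> R. Proof. by rewrite ltr0n. Qed.

Let G0 : 0 < #|G|%:R :> R.
Proof. by have /andP[_ ?] := kn; rewrite (lt_le_trans _ kG)// subr_gt0. Qed.

Let theta_le1 : theta <= 1.
Proof. by rewrite ler_pdivrMr// mul1r. Qed.

Let weightE (S : {set 'I_n}) : weight S = #|S|%:R - theta * #|S :&: G|%:R.
Proof.
rewrite /weight big_split/= sumr_const sumrN -mulr_sumr; congr (_ - _ * _).
rewrite -[RHS](sumr_const _ (1 : R)).
rewrite [RHS](eq_bigl (fun i => (i \in S) && (i \in G))) => [|i]; last first.
  by rewrite inE.
rewrite big_mkcondr.
by apply: eq_bigr => i _; case: (i \in G).
Qed.

Let weight_mono (S1 S2 : {set 'I_n}) : S1 \subset S2 -> weight S1 <= weight S2.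
Proof.
move=> S12; rewrite /weight [leRHS](big_setID S1)/= (finset.setIidPr S12) lerDl.
apply: sumr_ge0 => i _; rewrite subr_ge0.
by case: (i \in G); rewrite ?mulr1 ?theta_le1// mulr0.
Qed.

Let weight_ge0 (S : {set 'I_n}) : 0 <= weight S.
Proof.
rewrite -[leLHS](_ : weight finset.set0 = 0) ?weight_mono ?finset.sub0set//.
by rewrite /weight big_set0.
Qed.

Let weight_le (S : {set 'I_n}) : weight S <= k.
Proof.
rewrite (le_trans (weight_mono (finset.subsetT S)))// weightE finset.setTI.
rewrite cardsT card_ord.
by rewrite /theta divfK ?gt_eqF//; lra.
Qed.

Let A (l : nat) : R :=
  l%:R / n%:R - (1 - k / n%:R) * cdf_ext F0 (order_stat y l).
Let B (l : nat) : R :=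
  l%:R / n%:R - (1 - k / n%:R) * cdf_ext_left F0 (order_stat y l.+1).

Let A_le (l : nat) : (l <= n)%N ->
  A l - c <= weight (lower (order_stat y l)) / n%:R.
Proof.
move=> ln; have := dev_up (order_stat y l).
have := order_stat_card_le y ln; rewrite -/(lower _) -(ler_nat R) => h1.
rewrite weightE mulrBl /A.
have : l%:R / n%:R <= #|lower (order_stat y l)|%:R / n%:R :> R.
  by rewrite ler_pM2r ?invr_gt0.
lra.
Qed.

Let B_ge (l : nat) : (l <= n)%N ->
  weight (slower (order_stat y l.+1)) / n%:R <= B l + c.
Proof.
move=> ln; have := dev_down (order_stat y l.+1).
have := order_stat_card_lt y ln; rewrite -/(slower _) -(ler_nat R) => h1.
rewrite weightE mulrBl /B.
have : #|slower (order_stat y l.+1)|%:R / n%:R <= l%:R / n%:R :> R.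
  by rewrite ler_pM2r ?invr_gt0.
lra.
Qed.

Let A_le_B (l l' : nat) : (l <= l')%N -> (l' <= n)%N -> A l - c <= B l' + c.
Proof.
move=> ll' l'n; have ln := leq_trans ll' l'n.
have := order_stat_le y ll' l'n; rewrite le_eqVlt => /predU1P[eqY|ltY].
  (* With ties between Y_(l) and Y_(l' + 1) the counts are not comparable, but
     the two terms are then evaluated at the same point. *)
  rewrite /A /B eqY; set x := order_stat y l'.+1.
  have FF : cdf_ext_left F0 x <= cdf_ext F0 x.
    by case: x => [r| |] //=; exact: left_lim_le.
  have c0 : 0 <= c by exact: sqrtr_ge0.
  have s0 : 0 <= 1 - k / n%:R.
    by have /andP[_ ?] := kn; rewrite subr_ge0 ler_pdivrMr// mul1r ltW.
  have : l%:R / n%:R <= l'%:R / n%:R :> R.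
    by rewrite ler_pM2r ?invr_gt0 ?ler_nat.
  have := ler_wpM2l s0 FF; lra.
apply: (le_trans (A_le ln)); apply: le_trans (B_ge l'n).
rewrite ler_pM2r ?invr_gt0//; apply: weight_mono; apply/fintype.subsetP => i.
by rewrite !inE => /le_lt_trans; apply.
Qed.

Theorem confidence_region_of_deviation : confidence_region k alpha y F0.
Proof.
move=> j; rewrite /a_hat /b_hat.
set M := \big[maxe/-oo%E]_(l < n.+1 | _) _.
set N := \big[mine/+oo%E]_(l < n.+1 | _) _.
have k0 : 0 <= k / n%:R by have /andP[? _] := kn; rewrite divr_ge0// ltW.
have Mk : (M - c%:E <= (k / n%:R)%:E)%E.
  rewrite leeBlDr//; apply: bigmax_le => [|l _]; first exact: leNye.
  rewrite -EFinD lee_fin -lerBlDr; apply: (le_trans (A_le _)).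
    exact: leq_ord.
  by rewrite ler_pM2r ?invr_gt0 ?weight_le.
have N0 : (0 <= N + c%:E)%E.
  rewrite -leeBlDr// sub0e; apply: le_bigmin => [|l _]; first exact: leey.
  rewrite -EFinN lee_fin -subr_ge0 opprK.
  apply: le_trans (B_ge _); last exact: leq_ord.
  by rewrite divr_ge0 ?weight_ge0 ?ltW.
have MN : (M - c%:E <= N + c%:E)%E.
  rewrite leeBlDr//; apply: bigmax_le => [|l lj]; first exact: leNye.
  rewrite -leeBlDr// -leeBlDr//; apply: le_bigmin => [|l' jl'].
    exact: leey.
  rewrite -!EFinB lee_fin.
  have := A_le_B (leq_trans lj jl') (leq_ord l'); rewrite /A /B; lra.
(* When k = 0 this inverse is +oo, and the three inequalities above survive
   multiplication by it as 0 * +oo = 0. *)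
have inv0 : (0 <= (k / n%:R)%:E^-1)%E by rewrite inve_ge0 lee_fin.
have kk : ((k / n%:R)%:E * (k / n%:R)%:E^-1 <= 1)%E.
  rewrite inver; case: eqP => [->|/eqP h]; first by rewrite mul0e.
  by rewrite -EFinM divff.
rewrite ge_max !le_min lee01/= mule_ge0//=.
rewrite (le_trans (lee_wpmul2r inv0 Mk) kk)/=.
exact: lee_wpmul2r.
Qed.

End confidence_region_of_uniform_deviation.

(** If S contains j points of G, then z is at most v at j points; if v were
below j / #|G| - e, the family would exceed the band at j. *)
Lemma deviation_le_of_in_band (R : realType) (n : nat) (G S : {set 'I_n})
    (z : 'I_n -> R) (e v : R) : (0 < #|G|)%N -> 0 <= e -> 0 <= v ->
  (forall i, i \in S -> z i <= v) ->
  ~~ exceeds_band (fun i : 'I_#|G| => z (enum_val i)) e ->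
  #|S :&: G|%:R / #|G|%:R - v <= e.
Proof.
move=> G0 e0 v0 zv; rewrite negb_exists => /forallP noX.
have [S0|S0] := posnP #|S :&: G|; first by rewrite S0 mul0r; lra.
rewrite leNgt; apply/negP => dev.
have jlt : (#|S :&: G| < #|G|.+1)%N.
  by rewrite ltnS subset_leq_card// subsetIr.
move: (noX (Ordinal jlt)); rewrite S0/= => /negP; apply.
rewrite -(card_imset _ (@enum_val_inj _ G)).
apply/subset_leq_card/fintype.subsetP => i; rewrite !inE => /andP[iS iG].
apply/imsetP; exists (enum_rank_in iG i); last by rewrite enum_rankK_in.
by rewrite inE enum_rankK_in//; have := zv i iS; lra.
Qed.

(** * Measurability of the rejection event *)

(** An order statistic is at most x iff enough observations are, and each
coordinate contributes a measurable event to that count. *)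
Section measurability.
Context d (T : measurableType d) (R : realType) (n : nat) (Y : 'I_n -> T -> R).
Hypothesis mY : forall i, measurable_fun setT (Y i).

Lemma measurable_order_stat_real (l : nat) : (l < n)%N ->
  measurable_fun setT (fun t => order_stat_real (Y^~ t) l).
Proof.
move=> ln; apply: (measurability _ (RGenOInfty.measurableE R)) => //.
move=> _ [_ [x ->] <-]; rewrite setTI.
rewrite [X in measurable X](_ : _ =
    [set t | ~~ (l < #|[set i | (Y i t <= x)%R]%SET|)%N]).
  apply: (@measurable_finite_pattern _ _ _ (fun t (i : 'I_n) => Y i t <= x)
    (fun S => ~~ (l < #|S|)%N)) => i.
  have := mY i measurableT (measurable_itv `]-oo, x]); rewrite setTI.
  by congr measurable; apply/seteqP; split=> t /=; rewrite in_itv.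
by apply/seteqP; split=> t /=; rewrite in_itv/= andbT ltNge order_stat_real_le.
Qed.

Variables (F : \bar R -> R).
Hypothesis mF : measurable_fun setT (F \o EFin).

Lemma measurable_of_order_stat (l : nat) : (l <= n.+1)%N ->
  measurable_fun setT (fun t => F (order_stat (Y^~ t) l)).
Proof.
case: l => [|l]; first by move=> _; exact: (measurable_cst (F -oo%E)).
rewrite ltnS leq_eqVlt => /predU1P[->|ln].
  by under eq_fun do rewrite order_stat_top; exact: measurable_cst.
under eq_fun do rewrite order_statS//.
apply: (measurableT_comp mF); exact: measurable_order_stat_real.
Qed.

End measurability.

Lemma measurable_bigmaxe d (T : measurableType d) (R : realType) (I : finType)
    (D : pred I) (f : I -> T -> \bar R) :
  (forall i, measurable_fun setT (f i)) ->
  measurable_fun setT (fun t => \big[maxe/-oo%E]_(i | D i) f i t).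
Proof.
move=> mf; elim: (index_enum I) => [|i s ih].
  by under eq_fun do rewrite big_nil; exact: measurable_cst.
under eq_fun do rewrite big_cons; case: (D i) => //.
exact: measurable_maxe.
Qed.

Lemma measurable_bigmine d (T : measurableType d) (R : realType) (I : finType)
    (D : pred I) (f : I -> T -> \bar R) :
  (forall i, measurable_fun setT (f i)) ->
  measurable_fun setT (fun t => \big[mine/+oo%E]_(i | D i) f i t).
Proof.
move=> mf; elim: (index_enum I) => [|i s ih].
  by under eq_fun do rewrite big_nil; exact: measurable_cst.
under eq_fun do rewrite big_cons; case: (D i) => //.
exact: measurable_mine.
Qed.

Lemma measurable_left_lim (R : realType) (F0 : cdf_on R) :
  measurable_fun setT (left_lim F0).
Proof. by apply: nondecreasing_measurable => //; exact: left_lim_mono. Qed.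

Lemma measurable_cdf_on (R : realType) (F0 : cdf_on R) : measurable_fun setT F0.
Proof. by apply: nondecreasing_measurable => //; exact: cdf_mono. Qed.

Lemma measurable_rejection d (T : measurableType d) (R : realType) (n : nat)
    (Y : 'I_n -> T -> R) (k alpha : R) (F0 : cdf_on R) :
  (forall i, measurable_fun setT (Y i)) ->
  measurable [set t | ~ confidence_region k alpha (Y^~ t) F0].
Proof.
move=> mY.
have ma j : measurable_fun setT (fun t => a_hat k alpha (Y^~ t) F0 j).
  apply: measurable_maxe; first exact: measurable_cst.
  apply: emeasurable_funM; last exact: measurable_cst.
  apply: emeasurable_funB; last exact: measurable_cst.
  apply: measurable_bigmaxe => l; apply/measurable_EFinP.
  apply: measurable_funB; first exact: measurable_cst.
  apply: measurable_funM; first exact: measurable_cst.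
  apply: measurable_of_order_stat => //; last exact: ltnW.
  exact: measurable_cdf_on.
have mb j : measurable_fun setT (fun t => b_hat k alpha (Y^~ t) F0 j).
  apply: measurable_mine; first exact: measurable_cst.
  apply: emeasurable_funM; last exact: measurable_cst.
  apply: emeasurable_funD; last exact: measurable_cst.
  apply: measurable_bigmine => l; apply/measurable_EFinP.
  apply: measurable_funB; first exact: measurable_cst.
  apply: measurable_funM; first exact: measurable_cst.
  apply: measurable_of_order_stat => //.
  exact: measurable_left_lim.
rewrite [X in measurable X](_ : _ =
    \bigcup_j [set t |
      (b_hat k alpha (Y^~ t) F0 j < a_hat k alpha (Y^~ t) F0 j)%E]).
  apply: fin_bigcup_measurable; first exact: finite_finset.
  by move=> j _; rewrite -[X in measurable X]setTI; exact: measurable_lte.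
apply/seteqP; split=> t /=.
  move=> /existsNP[j /negP]; rewrite -ltNge => h; by exists j.
by move=> [j _ /= h] cr; have := cr j; rewrite leNgt h.
Qed.

(** * The level of the test *)

Theorem corollary6p2 (R : realType) (d : measure_display)
    (T : measurableType d) (P : probability T R) (n : nat)
    (Y : 'I_n -> {RV P >-> R}) (alpha k : R) (F0 : cdf_on R) :
  mutually_independent Y ->
  0 < alpha < 1 ->
  0 <= k <= n%:R - 1 ->
  null_cdfs k (fun i => cdf (Y i)) F0 ->
  (P [set t | ~ confidence_region k alpha (fun i => Y i t) F0] <= alpha%:E)%E.
Proof.
move=> indep /andP[a0 a1] /andP[k0 kn1].
rewrite /null_cdfs /=; set G := [set i : 'I_n | _]%SET => nullG.
have n0 : (0 < n)%N by rewrite -(ltr0n R); lra.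
have nR : 0 < n%:R :> R by rewrite ltr0n.
have kn : 0 <= k < n%:R by rewrite k0/=; lra.
have GR : 0 < #|G|%:R :> R by apply: lt_le_trans nullG; lra.
have G0 : (0 < #|G|)%N by rewrite -(ltr0n R).
set s := n%:R - k in nullG.
have s0 : 0 < s by rewrite /s; lra.
pose L := - ln (alpha / 2).
have L0 : 0 < L by rewrite oppr_gt0 ln_lt0//; lra.
have s1 : 1 - k / n%:R = s / n%:R by rewrite /s; field; rewrite gt_eqF.
set c := c_ n k alpha.
have c2 : c ^+ 2 = s * L / (2 * n%:R ^+ 2).
  rewrite /c /c_ s1 sqr_sqrtr; first by rewrite /L; field; rewrite gt_eqF.
  rewrite mulNr -mulrN -/L divr_ge0// ?mulr_ge0// ?ltW// divr_gt0//.
have c0 : 0 < c.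
  rewrite lt_def sqrtr_ge0 andbT -sqrf_eq0 c2 gt_eqF//.
  by rewrite divr_gt0 ?mulr_gt0// exprn_gt0.
(* Then (s / n) e = c and 2 #|G| e ^ 2 = (#|G| / s) L >= L. *)
pose e := n%:R * c / s.
have e0 : 0 < e by rewrite divr_gt0// mulr_gt0.
pose Z := fun i : 'I_#|G| => Y (enum_val i).
have indepZ : mutually_independent Z by exact: mutually_independent_enum_val.
have ZF i : cdf (Z i) = EFin \o F0.
  by have := enum_valP i; rewrite inE => /asboolP.
pose crossing (z : R -> R) := [set t | exceeds_band (fun i => z (Z i t)) e].
have Pcross (z : R -> R) : measurable_fun setT z ->
    (forall i (u : R), P (Z i @^-1` [set x | z x < u]%R) <=
      (Num.max 0%R u)%:E)%E ->
    measurable (crossing z) /\ (P (crossing z) <= (alpha / 2)%:E)%E.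
  move=> mz super; split.
    apply: (@measurable_exceeds_band _ _ _ _ (fun i => z \o Z i)) => i.
    by apply: measurableT_comp mz _; exact: measurable_funP.
  apply: (le_trans (superuniform_exceeds_band_le indepZ e0 mz super)).
  rewrite lee_fin -[leRHS]lnK ?posrE ?divr_gt0// ler_expR.
  rewrite -[leRHS]opprK lerN2 -/L.
  have -> : 2 * #|G|%:R * e ^+ 2 = (#|G|%:R / s) * L.
    by rewrite /e !exprMn c2; field; rewrite !gt_eqF.
  by rewrite ler_pMl// ler_pdivlMr// mul1r.
have [m1 P1] := Pcross F0 (measurable_cdf_on F0)
  (fun i => cdf_superuniform (ZF i)).
have mL : measurable_fun setT (fun x => 1 - left_lim F0 x).
  apply: measurable_funB; first exact: measurable_cst.
  exact: measurable_left_lim.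
have [m2 P2] := Pcross _ mL (fun i => ccdf_superuniform (ZF i)).
have mrej :
    measurable [set t | ~ confidence_region k alpha (fun i => Y i t) F0].
  by apply: measurable_rejection => i; exact: measurable_funP.
apply: (@le_trans _ _
  (P (crossing F0 `|` crossing (fun x => 1 - left_lim F0 x)))).
  rewrite le_measure ?inE//; first exact: measurableU.
  move=> t /= nocr; apply: contrapT => /not_orP[/negP no1 /negP no2].
  apply: nocr; apply: (@confidence_region_of_deviation _ _ _ _ _ _ G) => // x.
    rewrite -/c -/s s1.
    have v0 : 0 <= cdf_ext F0 x by case: x => [r| |] //=; exact: cdf_on_ge0.
    have := @deviation_le_of_in_band R n G
      [set i | ((Y i t)%:E <= x)%E]%SET (fun i => F0 (Y i t)) e _
      G0 (ltW e0) v0 _ no1.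
    case/(_ _)/Wrap => [|].
      move=> i; rewrite inE; case: x {v0} => [r| |] //=.
        by rewrite lee_fin; exact: cdf_mono.
      by rewrite cdf_on_le1.
    set N := #|_|; rewrite -(ler_pM2l (_ : 0 < s / n%:R)) ?divr_gt0//.
    rewrite (_ : s / n%:R * e = c); last by rewrite /e; field; rewrite !gt_eqF.
    apply: le_trans; rewrite le_eqVlt; apply/orP; left; apply/eqP.
    by field; rewrite !gt_eqF.
  rewrite -/c -/s s1.
  have v0 : 0 <= 1 - cdf_ext_left F0 x.
    case: x => [r| |] //=; rewrite ?subrr ?subr0//.
    by rewrite subr_ge0 (le_trans (left_lim_le F0 r)) ?cdf_on_le1.
  have := @deviation_le_of_in_band R n G
    (~: [set i | ((Y i t)%:E < x)%E])%SET (fun i => 1 - left_lim F0 (Y i t)) e _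
    G0 (ltW e0) v0 _ no2.
  case/(_ _)/Wrap => [|].
    move=> i; rewrite !inE -leNgt lerD2l lerN2; case: x {v0} => [r| |] //=.
      by rewrite lee_fin; exact: left_lim_mono.
    by move=> _; exact: left_lim_ge0.
  set N := [set i | _]%SET.
  have -> : #|~: N :&: G|%:R = #|G|%:R - #|N :&: G|%:R :> R.
    apply/eqP; rewrite eq_sym subr_eq -natrD -(cardsID N G) finset.setDE.
    by rewrite ![_ :&: G]finset.setIC addnC.
  rewrite -(ler_pM2l (_ : 0 < s / n%:R)) ?divr_gt0//.
  rewrite (_ : s / n%:R * e = c); last by rewrite /e; field; rewrite !gt_eqF.
  rewrite lerNl; apply: le_trans; rewrite le_eqVlt; apply/orP; left; apply/eqP.
  by rewrite /cdf_ext_left -/(left_lim F0 _); field; rewrite !gt_eqF.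
apply: (le_trans (measureU2 _ m1 m2)).
by rewrite [alpha in leRHS]splitr EFinD leeD.
Qed.
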